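(* Let $G$ be a $d$-regular graph on $n$ vertices with edge-vertex graph $\mathcal H$, let $\mu=\mu(G)$, and let $C$ be a $[d,rd,\epsilon d]$ linear code, where $d\epsilon>\mu$. Then the expander code $\mathcal C(\mathcal H,C)$, which has block length $nd/2$, has rate at least $2r-1$ and minimum relative distance at least $$\frac{\epsilon(d\epsilon-\mu)}{d-\mu}.$$
   Context: Graphs are finite, simple and undirected, with $n\ge 2$ vertices and $d\ge1$. For a graph $G$ on $n$ vertices with adjacency matrix $A$ and eigenvalues $\lambda_0\ge\lambda_1\ge\cdots\ge\lambda_{n-1}$ of $A$ (with multiplicity), $\mu(G)=\max\{\lambda_1,|\lambda_{n-1}|\}$. The edge-vertex graph $\mathcal H$ of $G$ is the bipartite graph whose input vertices (''variables'') are the $nd/2$ edges of $G$ and whose output vertices (''constraints'') are the $n$ vertices of $G$, an edge of $G$ being adjacent in $\mathcal H$ to its two endpoints. An $[N,K,D]$ linear code is a $K$-dimensional linear subspace of $\mathbb F^N$ ($\mathbb F$ a finite field) with minimum distance $D$, i.e. the minimum Hamming weight of a nonzero codeword is $D$. Thus $C$ has length $d$, dimension $rd$ and minimum distance $\epsilon d$ (so $\epsilon\le 1$, and $d\epsilon>\mu$ gives $d>\mu$). Expander code: write $N=nd/2$ and let $v_1,\dots,v_N$ be the variables and $\mathsf C_1,\dots,\mathsf C_n$ the constraints of $\mathcal H$. For each $i$ fix an ordering $v_{b(i,1)},\dots,v_{b(i,d)}$ of the $d$ variables adjacent to $\mathsf C_i$ (the orderings are arbitrary). Then $\mathcal C(\mathcal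 H,C)$ is the set of words $(x_1,\dots,x_N)\in\mathbb F^N$ such that $(x_{b(i,1)},\dots,x_{b(i,d)})\in C$ for every $1\le i\le n$. It is a linear code. Its rate is its dimension divided by $N$; its minimum relative distance is its minimum distance divided by $N$, and ''minimum relative distance at least $\beta$'' means that every nonzero codeword has Hamming weight at least $\beta N$. *)

(* Defs.v *)
From HB Require Import structures.
From mathcomp Require Import all_boot all_order all_algebra.
From mathcomp Require Import polyrcf.

Set Implicit Arguments.
Unset Strict Implicit.
Unset Printing Implicit Defensive.

Import Order.TTheory GRing.Theory Num.Theory.
Local Open Scope ring_scope.

(* A finite simple graph is a symmetric irreflexive relation on a finType. *)

Definition regular (V : finType) (e : rel V) (d : nat) : Prop :=
  forall v, #|[set w | e v w]| = d.

Definition edges (V : finType) (e : rel V) : {set {set V}} :=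
  [set [set p.1; p.2] | p : V * V & e p.1 p.2].

Definition adj_mx (R : nzRingType) (V : finType) (e : rel V) : 'M[R]_#|V| :=
  \matrix_(i, j) (e (enum_val i) (enum_val j))%:R.

(* The roots in R of the characteristic polynomial, each repeated according to
   its multiplicity, in nonincreasing order.  For a symmetric matrix these are
   all n eigenvalues. *)
Definition eigenvalues (R : rcfType) (n : nat) (A : 'M[R]_n) : seq R :=
  sort >=%R (flatten [seq nseq (mup x (char_poly A)) x
                     | x <- rootsR (char_poly A)]).

Definition graph_mu (R : rcfType) (V : finType) (e : rel V) : R :=
  let lambda := eigenvalues (adj_mx R e) in
  Num.max lambda`_1 `|lambda`_(#|V|.-1)|.

(* The variables (edges) are numbered by enum_val; the constraints are the
   vertices. *)
Definition edge_vertex (V : finType) (e : rel V) (k : 'I_#|edges e|) (v : V)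
  : bool := v \in enum_val k.

Definition hweight (F : nzRingType) (N : nat) (x : 'rV[F]_N) : nat :=
  #|[set k | x 0 k != 0]|.

Definition has_min_dist (F : finFieldType) (N : nat)
    (C : {vspace 'rV[F]_N}) (D : nat) : Prop :=
  (exists x, [/\ x \in C, x != 0 & hweight x = D]) /\
  (forall x, x \in C -> x != 0 -> (D <= hweight x)%N).

Definition linear_code (F : finFieldType) (N K D : nat)
    (C : {vspace 'rV[F]_N}) : Prop :=
  \dim C = K /\ has_min_dist C D.

Definition rate (R : rcfType) (F : finFieldType) (N : nat)
    (C : {vspace 'rV[F]_N}) : R :=
  (\dim C)%:R / N%:R.

Definition min_rel_dist_ge (R : rcfType) (F : finFieldType) (N : nat)
    (C : {vspace 'rV[F]_N}) (beta : R) : Prop :=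
  forall x, x \in C -> x != 0 -> beta * N%:R <= (hweight x)%:R.

(* b i 0, ..., b i (d - 1) lists, without repetition, exactly the variables
   adjacent to the constraint i. *)
Definition orderings (N : nat) (O : finType) (H : 'I_N -> O -> bool) (d : nat)
    (b : O -> 'I_d -> 'I_N) : Prop :=
  forall i, injective (b i) /\ (forall k, H k i <-> exists j, b i j = k).

Definition expander_code (F : finFieldType) (N : nat) (O : finType) (d : nat)
    (b : O -> 'I_d -> 'I_N) (C : {vspace 'rV[F]_d}) : {vspace 'rV[F]_N} :=
  (\bigcap_(i : O) (linfun (colsub (b i)) @^-1: C))%VS.

Lemma mem_expander_code (F : finFieldType) (N : nat) (O : finType) (d : nat)
    (b : O -> 'I_d -> 'I_N) (C : {vspace 'rV[F]_d}) (x : 'rV[F]_N) :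
  x \in expander_code b C <-> forall i, \row_j x 0 (b i j) \in C.
Proof.
have E i : (x \in (linfun (colsub (b i)) @^-1: C)%VS)
         = (\row_j x 0 (b i j) \in C).
  rewrite -memv_preim lfunE /=.
  suff -> : colsub (b i) x = \row_j x 0 (b i j) by [].
  by apply/rowP => j; rewrite !mxE.
rewrite memvE; split=> [/subv_bigcapP xC i | xC].
  by rewrite -E memvE; apply: xC.
by apply/subv_bigcapP => i _; rewrite -memvE E.
Qed.

Lemma eigenvaluesE (R : rcfType) (n : nat) (A : 'M[R]_n) (s : seq R) :
  char_poly A = \prod_(x <- s) ('X - x%:P) -> sorted >=%R s ->
  eigenvalues A = s.
Proof.
move=> sE ss.
apply: (sorted_eq (leT := >=%R)) => //.
- by move=> x y z /= h1 h2; apply: le_trans h2 h1.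
- by move=> x y /= /andP[h1 h2]; apply: le_anti; rewrite h1 h2.
- by apply: sort_sorted => x y /=; apply: le_total.
rewrite /eigenvalues perm_sort; apply/allP => y _ /=; apply/eqP.
have p0 : char_poly A != 0 by rewrite monic_neq0 ?char_poly_monic.
have Ec z : mup z (char_poly A) = count_mem z s.
  by rewrite sE mu_prod_XsubC.
have := roots_on_rootsR p0 => /(_ y); rewrite in_itv /= => Hr.
rewrite -Ec count_flatten -map_comp sumnE big_map.
under eq_bigr do rewrite /= count_nseq.
have [yin|yout] := boolP (y \in rootsR (char_poly A)).
  rewrite (bigD1_seq y) ?uniq_roots //= eqxx mul1n big1 ?addn0 // => z.
  by move=> zy /=; rewrite (negPf zy).
rewrite mupNroot; last by rewrite Hr.
rewrite big1_seq // => z /= zin; case: eqP => [zy|//].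
by rewrite -zy zin in yout.
Qed.

(* Main.v *)
Require Import Defs.
From HB Require Import structures.
From mathcomp Require Import all_boot all_order all_algebra.
From mathcomp Require Import complex zify ring lra.

(* Let X be the support of a nonzero codeword of weight w, and S the set of
   vertices meeting X.  The local word at each vertex of S is a nonzero word of
   C, so double counting incidences gives D |S| <= 2 w.  On the other hand X
   lies inside the subgraph induced on S, and the expander mixing argument gives
   2 w <= mu |S| + (d - mu) |S|^2 / n: split the indicator vector of S along the
   all-ones eigenvector and bound the quadratic form of the adjacency matrix on
   the orthogonal complement by the second eigenvalue.  Hence
   |S| >= n (D - mu) / (d - mu) and w >= D |S| / 2.  The rate bound counts the
   d - K linear constraints imposed at each of the n vertices.  As
   lambda_1 <= mu < D <= d, the eigenvalue d is simple, so neither a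
   Perron-Frobenius argument nor connectedness of G is needed. *)

Set Implicit Arguments.
Unset Strict Implicit.
Unset Printing Implicit Defensive.

Import Order.TTheory GRing.Theory Num.Theory.
Local Open Scope ring_scope.

(** * Spectral theorem and the Rayleigh bound for the second eigenvalue *)

Section Rayleigh.
Local Open Scope sesquilinear_scope.
Local Notation "x %:C" := (real_complex _ x) : ring_scope.
Local Notation cC := (map_mx (real_complex _)).

Lemma conj_real_complex (R : rcfType) (x : R) : (x%:C)^* = x%:C.
Proof. by apply/CrealP; rewrite complex_real. Qed.

Lemma trC_map_real (R : rcfType) m n (M : 'M[R]_(m, n)) :
  (map_mx (real_complex R) M)^t* = map_mx (real_complex R) M^T.
Proof. by apply/matrixP => i j; rewrite !mxE conj_real_complex. Qed.

Lemma char_poly_similar (K : comUnitRingType) n (P A : 'M[K]_n) :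
  P \in unitmx -> char_poly (invmx P *m A *m P) = char_poly A.
Proof.
move=> unitP; rewrite /char_poly /char_poly_mx !map_mxM.
set Q := map_mx _ P; set Q' := map_mx _ (invmx P).
have QK : Q' *m Q = 1%:M by rewrite -map_mxM mulVmx // map_mx1.
have {1}-> : 'X%:M = Q' *m 'X%:M *m Q by rewrite scalar_mxC -mulmxA QK mulmx1.
by rewrite -mulmxBl -mulmxBr !det_mulmx mulrAC -det_mulmx QK det1 mul1r.
Qed.

(** Diagonalization takes place over [R[i]], where the spectral theorem for normal matrices is
    available; symmetry makes the diagonal real, so only [U] stays complex. The diagonal comes in no
    particular order, whence [perm_eq]. *)
Lemma symmetric_spectral (R : rcfType) n (A : 'M[R]_n) : A^T = A ->
  exists (U : 'M[R[i]]_n) (l : 'rV[R]_n),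
    [/\ U \is unitarymx,
        map_mx (real_complex R) A
          = U^t* *m diag_mx (map_mx (real_complex R) l) *m U
      & perm_eq (eigenvalues A) [seq l 0 i | i <- enum 'I_n]].
Proof.
move=> symA; set B := map_mx _ A.
have symB : B \is symmetricmx.
  apply/is_hermitianmxP; rewrite expr0 scale1r map_mx_id //.
  by rewrite /B map_trmx symA.
have realB : B \is a mxOver Num.real.
  by apply/mxOverP => i j; rewrite mxE complex_real.
have /orthomx_spectralP := symmetric_normalmx symB realB.
have /hermitian_spectral_diag_real := realsym_hermsym symB realB.
have := spectral_unitarymx B.
set U := spectralmx B; set s := spectral_diag B => unitU /mxOverP realS BE.
pose l : 'rV[R]_n := \row_i complex.Re (s 0 i).
have sE : s = map_mx (real_complex R) l.
  by apply/rowP => i; rewrite !mxE [RHS]RRe_real.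
exists U, l; split=> //; first by rewrite -sE -invmx_unitary.
have charA :
    char_poly A = \prod_(x <- [seq l 0 i | i <- enum 'I_n]) ('X - x%:P).
  apply: (map_poly_inj (real_complex R)); rewrite map_char_poly -/B BE.
  rewrite char_poly_similar ?unitarymx_unit //.
  rewrite char_poly_trig ?diag_mx_is_trig // rmorph_prod.
  rewrite big_map big_enum; apply: eq_bigr => i _ /=.
  by rewrite map_polyXsubC sE !mxE eqxx.
have := eigenvaluesE (s := sort >=%R [seq l 0 i | i <- enum 'I_n]).
move=> ->; first by rewrite perm_sort.
  by rewrite charA; apply/perm_big; rewrite perm_sym perm_sort.
by apply: sort_sorted => x y; apply: le_total.
Qed.

(** In a nonincreasing list only the head can exceed the entry of index 1. A list with fewer than
    two entries reads the default 0 there, and the bound is then trivial. *)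
Lemma count_gt_second (R : rcfType) n (A : 'M[R]_n) :
  (count (> (eigenvalues A)`_1)%R (eigenvalues A) <= 1)%N.
Proof.
have : sorted >=%R (eigenvalues A).
  by apply: sort_sorted => x y; apply: le_total.
case: (eigenvalues A) => [|x [|y s]] //=; first by rewrite addn0 leq_b1.
rewrite ltxx add0n => /andP[_ ys]; rewrite [X in (_ + X)%N](_ : _ = 0%N).
  by rewrite addn0 leq_b1.
apply/eqP; rewrite -leqn0 leqNgt -has_count; apply/hasPn => z zs.
rewrite -leNgt; have/allP := order_path_min (rev_trans le_trans) ys.
by apply.
Qed.

(** Since [a] lies above the second eigenvalue, it sits at a single index [i0] of the spectral
    decomposition. There [u] has its only nonzero coordinate, so [x], being orthogonal to [u], has
    coordinate zero at [i0], and every other diagonal entry is at most the second eigenvalue. *)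
Lemma rayleigh_second (R : rcfType) n (A : 'M[R]_n) (a : R) (u x : 'rV[R]_n) :
  A^T = A -> u != 0 -> u *m A = a *: u -> (eigenvalues A)`_1 < a ->
  x *m u^T = 0 ->
  (x *m A *m x^T) 0 0 <= (eigenvalues A)`_1 * (x *m x^T) 0 0.
Proof.
move=> symA u0 uA; set s := (eigenvalues A)`_1 => lt_sa xu.
have [U [l [unitU AE lE]]] := symmetric_spectral symA.
have UK : U^t* *m U = 1%:M.
  by rewrite -invmx_unitary // mulVmx // unitarymx_unit.
(* Coordinates of [x] and [u] in the orthonormal eigenbasis. *)
pose y := cC x *m U^t*; pose w := cC u *m U^t*.
have yK : y *m U = cC x by rewrite /y -mulmxA UK mulmx1.
have w_neq0 : w != 0.
  apply: contra u0 => /eqP w0.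
  have : cC u = 0 by rewrite -[LHS]mulmx1 -UK mulmxA -/w w0 mul0mx.
  by move/eqP; rewrite map_mx_eq0.
have wl i : w 0 i * (l 0 i)%:C = a%:C * w 0 i.
  have /(congr1 (fun M => cC M *m U^t*)) /= := uA.
  rewrite map_mxM map_mxZ AE !mulmxA mulmxtVK // -scalemxAl.
  by move=> /rowP/(_ i); rewrite -/w mul_mx_diag !mxE.
have yw : \sum_i y 0 i * (w 0 i)^* = 0.
  have : y *m w^t* = 0.
    rewrite /w trmx_mul map_mxM trmxCK mulmxA yK trC_map_real -map_mxM xu.
    by rewrite map_mx0.
  move=> /matrixP/(_ 0 0); rewrite !mxE => {2}<-.
  by apply: eq_bigr => i _; rewrite !mxE.
have [i0 wi0] : exists i, w 0 i != 0 by apply/rV0Pn.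
have li0 : l 0 i0 = a.
  by apply: (@complexI R); apply: (mulfI wi0); rewrite wl mulrC.
have l_le i : i != i0 -> l 0 i <= s.
  move=> ii0; rewrite leNgt; apply/negP => lt_sl.
  have := count_gt_second A; rewrite (permP lE) count_map.
  rewrite -size_filter leqNgt => /negP; apply.
  (* Otherwise [i] and [i0] would be two indices whose values exceed [s]. *)
  apply: (@uniq_leq_size _ [:: i; i0]) => [|j]; first by rewrite /= inE ii0.
  rewrite !inE mem_filter mem_enum /= andbT.
  by case/orP => /eqP-> //; rewrite li0.
have yi0 : y 0 i0 = 0.
  have wi i : i != i0 -> w 0 i = 0.
    move=> /l_le lei; apply/eqP; apply: contraTT (le_lt_trans lei lt_sa) => wi.
    by rewrite -leNgt -lecR; move: (wl i); rewrite mulrC => /(mulIf wi) ->.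
  move: yw; rewrite (bigD1 i0) //= big1 ?addr0 => [/eqP|i /wi ->]; last first.
    by rewrite conjC0 mulr0.
  by rewrite mulf_eq0 conjC_eq0 (negPf wi0) orbF => /eqP.
have xx : ((x *m x^T) 0 0)%:C = \sum_i `|y 0 i| ^+ 2.
  have -> : ((x *m x^T) 0 0)%:C = (y *m y^t*) 0 0.
    rewrite {2}/y trmx_mul map_mxM trmxCK mulmxA yK trC_map_real -map_mxM.
    by rewrite [RHS]mxE.
  by rewrite mxE; apply: eq_bigr => i _; rewrite !mxE normCK.
have xAx : ((x *m A *m x^T) 0 0)%:C = \sum_i (l 0 i)%:C * `|y 0 i| ^+ 2.
  have -> : ((x *m A *m x^T) 0 0)%:C = (y *m diag_mx (cC l) *m y^t*) 0 0.
    rewrite {2}/y trmx_mul map_mxM trmxCK trC_map_real.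
    have -> : y *m diag_mx (cC l) = cC (x *m A) *m U^t*.
      by rewrite map_mxM AE !mulmxA mulmxtVK.
    by rewrite mulmxA mulmxKtV // -map_mxM [RHS]mxE.
  rewrite mul_mx_diag mxE; apply: eq_bigr => i _.
  by rewrite !mxE normCK mulrAC mulrC.
rewrite -lecR xAx rmorphM /= xx mulr_sumr; apply: ler_sum => i _.
have [->|/l_le lei] := eqVneq i i0; first by rewrite yi0 normr0 expr0n !mulr0.
by rewrite ler_wpM2r ?exprn_ge0 // lecR.
Qed.
End Rayleigh.

(** Write [s] as [c *: o + x] with [o] the all-ones vector and [x] orthogonal to it. Cross terms
    vanish because [o] is an eigenvector; the constant part contributes [a * c ^+ 2 * n], and the
    Rayleigh bound controls [x]. *)
Lemma quadratic_form_le (R : rcfType) n (A : 'M[R]_n) (a mu : R)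
    (s : 'rV[R]_n) :
  (0 < n)%N -> A^T = A -> const_mx 1 *m A = a *: const_mx 1 :> 'rV_n ->
  (eigenvalues A)`_1 <= mu -> mu < a ->
  (s *m A *m s^T) 0 0
    <= mu * (s *m s^T) 0 0 + (a - mu) / n%:R * (\sum_i s 0 i) ^+ 2.
Proof.
move=> n_gt0 symA oneA le_mu lt_mu; set t := \sum_i _.
pose o : 'rV[R]_n := const_mx 1.
have nn0 : n%:R != 0 :> R by rewrite pnatr_eq0 -lt0n.
have so : s *m o^T = t%:M.
  apply/matrixP => i j; rewrite !ord1 !mxE mulr1n; apply: eq_bigr => k _.
  by rewrite !mxE mulr1.
have os : o *m s^T = t%:M by rewrite -[LHS]trmxK trmx_mul trmxK so tr_scalar_mx.
have oo : o *m o^T = n%:R%:M.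
  apply/matrixP => i j; rewrite !ord1 !mxE mulr1n.
  under eq_bigr do rewrite !mxE mulr1.
  by rewrite sumr_const card_ord.
have o0 : o != 0.
  by apply/eqP => /rowP/(_ (Ordinal n_gt0)) /eqP; rewrite !mxE oner_eq0.
have Ao : A *m o^T = a *: o^T by rewrite -[A]symA -trmx_mul oneA linearZ.
(* [c] is the mean of the entries of [s], which makes the entries of [x] sum to zero. *)
pose c := t / n%:R; pose x := s - c *: o.
have tE : t = c * n%:R by rewrite /c divfK.
have xo : x *m o^T = 0.
  by rewrite mulmxBl -scalemxAl so oo scale_scalar_mx -tE subrr.
have xx : (x *m x^T) 0 0 = (s *m s^T) 0 0 - c ^+ 2 * n%:R.
  rewrite {2}/x linearB linearZ /= mulmxBr -scalemxAr xo scaler0 subr0.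
  by rewrite mulmxBl -scalemxAl os !mxE mulr1n tE mulrA.
have xAx : (x *m A *m x^T) 0 0 = (s *m A *m s^T) 0 0 - a * (c ^+ 2 * n%:R).
  rewrite {2}/x linearB linearZ /= mulmxBr -scalemxAr -[_ *m o^T]mulmxA Ao.
  rewrite -scalemxAr xo !scaler0 subr0 !mulmxBl -!scalemxAl oneA -scalemxAl os.
  by rewrite !mxE mulr1n tE; ring.
have := rayleigh_second symA o0 oneA (le_lt_trans le_mu lt_mu) xo.
have : (eigenvalues A)`_1 * (x *m x^T) 0 0 <= mu * (x *m x^T) 0 0.
  apply: ler_wpM2r => //; rewrite mxE; apply: sumr_ge0 => i _.
  by rewrite !mxE -expr2 sqr_ge0.
move=> h1 h2; have := le_trans h2 h1; rewrite xx xAx.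
have -> : (a - mu) / n%:R * t ^+ 2 = (a - mu) * (c ^+ 2 * n%:R).
  by rewrite tE; field.
lra.
Qed.

(** The left side is the quadratic form of the adjacency matrix at the indicator vector of [S];
    regularity makes the all-ones vector an eigenvector for [d]. *)
Lemma induced_degree_sum_le (R : rcfType) (V : finType) (e : rel V) (d : nat)
    (S : {set V}) :
  symmetric e -> (0 < #|V|)%N -> regular e d -> graph_mu R e < d%:R ->
  (\sum_(u in S) #|[set w in S | e u w]|)%:R
    <= graph_mu R e * #|S|%:R
       + (d%:R - graph_mu R e) / #|V|%:R * #|S|%:R ^+ 2.
Proof.
move=> e_sym V_gt0 e_reg mu_lt.
have enumE (G : V -> R) : \sum_(i < #|V|) G (enum_val i) = \sum_v G v.
  by rewrite -big_enum_val.
have symA : (adj_mx R e)^T = adj_mx R e.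
  by apply/matrixP => i j; rewrite !mxE e_sym.
pose ind v : R := (v \in S)%:R.
have sum_ind : \sum_v ind v = #|S|%:R.
  rewrite -sum1_card natr_sum [RHS]big_mkcond; apply: eq_bigr => v _.
  by rewrite /ind; case: (v \in S).
have oneA : const_mx 1 *m adj_mx R e = d%:R *: const_mx 1 :> 'rV_#|V|.
  apply/rowP => j; rewrite !mxE mulr1 -(e_reg (enum_val j)).
  under eq_bigr do rewrite !mxE mul1r e_sym.
  rewrite (enumE (fun v => (e (enum_val j) v)%:R)) -sum1_card natr_sum.
  rewrite [RHS]big_mkcond; apply: eq_bigr => v _.
  by rewrite inE; case: (e _ _).
pose s : 'rV[R]_#|V| := \row_i ind (enum_val i).
have mu_ge : (eigenvalues (adj_mx R e))`_1 <= graph_mu R e.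
  by rewrite /graph_mu le_max lexx.
have := quadratic_form_le s V_gt0 symA oneA mu_ge mu_lt.
have -> : \sum_i s 0 i = #|S|%:R.
  by under eq_bigr do rewrite mxE; rewrite enumE.
have -> : (s *m s^T) 0 0 = #|S|%:R.
  rewrite mxE; under eq_bigr do rewrite !mxE.
  rewrite (enumE (fun v => ind v * ind v)) -sum_ind; apply: eq_bigr => v _.
  by rewrite /ind; case: (v \in S); rewrite ?mulr1 ?mulr0.
suff -> : (s *m adj_mx R e *m s^T) 0 0
  = (\sum_(u in S) #|[set w in S | e u w]|)%:R by [].
transitivity (\sum_w (\sum_u ind u * (e u w)%:R) * ind w).
  rewrite mxE -enumE; apply: eq_bigr => j _; rewrite !mxE; congr (_ * _).
  rewrite -(enumE (fun u => ind u * (e u (enum_val j))%:R)).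
  by apply: eq_bigr => i _; rewrite !mxE.
under [LHS]eq_bigr do rewrite mulr_suml.
rewrite exchange_big natr_sum [RHS]big_mkcond; apply: eq_bigr => u _ /=.
rewrite {1}/ind; case: (u \in S); last first.
  by apply: big1 => w _; rewrite !mul0r.
rewrite -sum1_card natr_sum [RHS]big_mkcond; apply: eq_bigr => w _ /=.
by rewrite inE /ind; case: (w \in S); case: (e u w);
  rewrite ?(mul1r, mulr1, mulr0).
Qed.

(** * Incidences between edges and vertices *)

Lemma card_edge (V : finType) (e : rel V) (k : 'I_#|edges e|) :
  irreflexive e -> #|enum_val k| = 2.
Proof.
move=> e_irr; have /imsetP[[u v] /= uv ->] := enum_valP k.
rewrite cards2; case: eqVneq uv => //= ->.
by rewrite inE /= e_irr.
Qed.

Lemma sum_edge_degree (V : finType) (e : rel V) (X : {set 'I_#|edges e|}) :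
  irreflexive e ->
  (\sum_v #|[set k in X | edge_vertex k v]| = 2 * #|X|)%N.
Proof.
move=> e_irr.
under eq_bigr do rewrite -sum1dep_card big_mkcondr /=.
rewrite exchange_big /= mulnC -sum_nat_const; apply: eq_bigr => k _.
by rewrite -big_mkcond sum1_card /= (card_edge k e_irr).
Qed.

(** An edge of [X] at [u] has the form [[set u; w]], and its other endpoint [w] is a neighbour of
    [u] lying in [S]; so these edges lie in the image of the neighbours of [u] in [S]. *)
Lemma edge_degree_le (V : finType) (e : rel V) (X : {set 'I_#|edges e|})
    (S : {set V}) (u : V) :
  symmetric e -> (forall k v, k \in X -> edge_vertex k v -> v \in S) ->
  (#|[set k in X | edge_vertex k u]| <= #|[set w in S | e u w]|)%N.
Proof.
move=> e_sym XS; rewrite -(card_imset _ enum_val_inj).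
apply: leq_trans (leq_imset_card (fun w => [set u; w]) _).
apply: subset_leq_card; apply/subsetP => _ /imsetP[k + ->].
rewrite inE /edge_vertex => /andP[kX uk].
have := XS k _ kX; rewrite /edge_vertex.
have /imsetP[[v w] /= vw kE] := enum_valP k; rewrite inE /= in vw.
move: uk; rewrite kE !inE => /orP[]/eqP-> inS; apply/imsetP.
  by exists w; rewrite // inE vw inS // !inE eqxx orbT.
by exists v; rewrite 1?setUC // inE e_sym vw inS // !inE eqxx.
Qed.

Lemma card_incident_edges (V : finType) (e : rel V) d
    (b : V -> 'I_d -> 'I_#|edges e|) v :
  orderings (@edge_vertex V e) b -> #|[set k | @edge_vertex V e k v]| = d.
Proof.
case/(_ v) => b_inj b_im; rewrite -[RHS]card_ord -(card_imset _ b_inj).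
apply: eq_card => k; rewrite inE; apply/idP/imsetP.
  by move=> /b_im[j <-]; exists j.
by move=> [j _ ->]; apply/b_im; exists j.
Qed.

(** * Dimension counting for linear constraints *)

(** Taking preimages does not raise codimension: [f] maps the preimage onto the intersection of [W]
    with its image, with kernel [lker f], and rank-nullity is applied both there and on the whole
    space. *)
Lemma dim_lpreim_ge (K : fieldType) (aT rT : vectType K) (f : 'Hom(aT, rT))
    (W : {vspace rT}) :
  (\dim {:aT} + \dim W <= \dim (f @^-1: W) + \dim {:rT})%N.
Proof.
have kerW : (lker f <= f @^-1: W)%VS by rewrite -lpreim0 lpreimS ?sub0v.
have := limg_ker_dim f (f @^-1: W).
rewrite -[in (f @: _)%VS]lpreim_cap_limg lpreimK ?capvSr //.
rewrite (capv_idPr kerW) => <-.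
have := limg_ker_dim f fullv; rewrite capfv => <-.
have := dimv_sum_cap W (limg f); have := dimvS (subvf (W + limg f)).
lia.
Qed.

(** Codimension is subadditive under intersection; adding [c] on the right avoids truncated
    subtraction. *)
Lemma dim_bigcap_ge (K : fieldType) (vT : vectType K) (I : finType)
    (W : I -> {vspace vT}) (c : nat) :
  (forall i, \dim {:vT} <= \dim (W i) + c)%N ->
  (\dim {:vT} <= \dim (\bigcap_i W i) + #|I| * c)%N.
Proof.
move=> W_ge; rewrite -big_enum cardT.
elim: (enum I) => [|i s IHs]; first by rewrite big_nil mul0n addn0.
rewrite big_cons /=; set U := \big[_/_]_(_ <- _) _ in IHs *.
have := dimv_sum_cap (W i) U; have := dimvS (subvf (W i + U)).
have := W_ge i; lia.
Qed.

(** * Block length, rate and distance of the expander code *)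

Theorem theorem3 (R : rcfType) (F : finFieldType) (V : finType) (e : rel V)
    (d K D : nat) (r eps : R) (C : {vspace 'rV[F]_d})
    (b : V -> 'I_d -> 'I_#|edges e|)
    (e_sym : symmetric e) (e_irr : irreflexive e)
    (n_ge2 : (2 <= #|V|)%N) (d_ge1 : (1 <= d)%N)
    (e_reg : regular e d)
    (KE : K%:R = r * d%:R) (DE : D%:R = eps * d%:R)
    (C_code : linear_code K D C)
    (mu_lt : graph_mu R e < d%:R * eps)
    (b_ord : orderings (@edge_vertex V e) b) :
  [/\ #|edges e|%:R = #|V|%:R * d%:R / 2 :> R,
      2 * r - 1 <= rate R (expander_code b C)
    & min_rel_dist_ge (expander_code b C)
        (eps * (d%:R * eps - graph_mu R e) / (d%:R - graph_mu R e))].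
Proof.
have [dimC [[x0 [_ _ x0D]] minC]] := C_code.
have V_gt0 : 0 < #|V|%:R :> R by rewrite ltr0n ltnW.
have d_gt0 : 0 < d%:R :> R by rewrite ltr0n.
have edgesE : (2 * #|edges e| = #|V| * d)%N.
  have := sum_edge_degree setT e_irr; rewrite cardsT card_ord => <-.
  rewrite -sum_nat_const; apply: eq_bigr => v _.
  rewrite -(card_incident_edges v b_ord).
  by apply: eq_card => k; rewrite !inE.
have edgesR : 2 * #|edges e|%:R = #|V|%:R * d%:R :> R by rewrite -!natrM edgesE.
have N_gt0 : 0 < #|edges e|%:R :> R by have := mulr_gt0 V_gt0 d_gt0; lra.
split; first by rewrite -edgesR mulrC mulKf // pnatr_eq0.
  rewrite /rate ler_pdivlMr //.
  have lpre_ge i : (\dim {:'rV[F]_#|edges e|}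
      <= \dim (linfun (colsub (b i)) @^-1: C) + (d - K))%N.
    have := dim_lpreim_ge (linfun (colsub (b i))) C.
    have := dimvS (subvf C); rewrite dimC !dimvf /dim /= !mul1n; lia.
  have := dim_bigcap_ge lpre_ge; rewrite -/(expander_code b C).
  have Kd : (K <= d)%N.
    by have := dimvS (subvf C); rewrite dimC !dimvf /dim /= !mul1n.
  (* With [N] edges and [n] vertices, [n * d = 2 * N] turns the total loss [n * (d - r * d)] into
     [2 * N * (1 - r)], leaving dimension at least [(2 * r - 1) * N]. *)
  rewrite !dimvf /dim /= !mul1n -(ler_nat R) natrD natrM natrB // KE.
  move: edgesR; nra.
move=> x xC x_neq0.
set mu := graph_mu R e in mu_lt *; set w := hweight x.
(* A minimum-weight word of [C] has only [d] positions; this yields [mu < d], so the denominator is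
   positive. *)
have Dd : D%:R <= d%:R :> R.
  by rewrite -x0D ler_nat (leq_trans (max_card _)) // card_ord.
have muD : mu < D%:R by rewrite DE mulrC.
have mu_d := lt_le_trans muD Dd.
pose X := [set k | x 0 k != 0].
pose S := [set v | [exists k in X, @edge_vertex V e k v]].
have XS k v : k \in X -> edge_vertex k v -> v \in S.
  by move=> kX kv; rewrite inE; apply/exists_inP; exists k.
(* Vertices outside [S] meet no edge of [X], so restricting the incidence count to [S] loses
   nothing. *)
have sumS : (\sum_(v in S) #|[set k in X | edge_vertex k v]| = 2 * w)%N.
  rewrite -(sum_edge_degree X e_irr) big_mkcond; apply: eq_bigr => v _.
  case: ifPn => // vS; apply/esym/eqP; rewrite cards_eq0; apply/eqP/setP => k.
  by rewrite !inE; apply: contraNF vS => /andP[kX]; apply: XS; rewrite inE.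
have S_ge : (D * #|S| <= 2 * w)%N.
  rewrite -sumS mulnC -sum_nat_const; apply: leq_sum => v.
  rewrite inE => /exists_inP[k kX kv].
  have /mem_expander_code/(_ v) yC := xC.
  set y := \row_j _ in yC.
  have [b_inj b_im] := b_ord v.
  (* The edge [k] of [X] at [v] is listed by [b v] at some position, where the local word takes the
     nonzero value of [x] at [k]. *)
  have y_neq0 : y != 0.
    have /b_im[j jk] := kv; apply: contraTneq kX => /rowP/(_ j).
    by rewrite !mxE jk inE => ->; rewrite eqxx.
  apply: leq_trans (minC y yC y_neq0) _.
  (* [b v] injects the support of the local word into the edges of [X] at [v]. *)
  rewrite /hweight -(card_imset _ b_inj); apply: subset_leq_card.
  apply/subsetP => _ /imsetP[j + ->]; rewrite !inE mxE => -> /=.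
  by apply/b_im; exists j.
have S_le : (2 * w)%:R <= mu * #|S|%:R + (d%:R - mu) / #|V|%:R * #|S|%:R ^+ 2.
  apply: le_trans (induced_degree_sum_le S e_sym (ltnW n_ge2) e_reg mu_d).
  rewrite -sumS ler_nat; apply: leq_sum => u _.
  exact: edge_degree_le.
have S_gt0 : 0 < #|S|%:R :> R.
  have /rV0Pn[k xk] := x_neq0.
  have : (0 < #|enum_val k|)%N by rewrite card_edge.
  case/card_gt0P => v kv; rewrite ltr0n; apply/card_gt0P; exists v.
  by apply: (XS k) => //; rewrite inE.
move: S_ge; rewrite -(ler_nat R) !natrM => S_ge.
(* The lower and upper bounds on [2 * w] are compared and divided by the positive size of [S]. *)
have DS : D%:R - mu <= (d%:R - mu) / #|V|%:R * #|S|%:R.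
  rewrite -(ler_pM2r S_gt0) mulrBl; move: S_le; rewrite natrM; lra.
have DSV : (D%:R - mu) / (d%:R - mu) * #|V|%:R <= #|S|%:R.
  rewrite mulrAC ler_pdivrMr ?subr_gt0 // -ler_pdivlMr //.
  by rewrite -mulrA mulrC.
have D_ge0 : 0 <= D%:R :> R by [].
have := ler_wpM2l D_ge0 DSV.
(* The target weight is [D / 2] times the lower bound just found for the size of [S], so [S_ge]
   concludes. *)
have -> : eps * (d%:R * eps - mu) / (d%:R - mu) * #|edges e|%:R
    = D%:R * ((D%:R - mu) / (d%:R - mu) * #|V|%:R) / 2.
  rewrite (_ : #|edges e|%:R = #|V|%:R * d%:R / 2); last by lra.
  by rewrite DE; field; rewrite subr_eq0 gt_eqF.
lra.
Qed.
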